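(* Let $f(z) = \sum_{n \in \mathbb{Z}} \frac{1}{(z-n)^2}$ for $z \in \mathbb{C} \setminus \mathbb{Z}$, and let $g = 1/f$ be its reciprocal, regarded as an entire function (with value $0$ at each integer). Let $\pi$ denote the positive number defined by $\pi^2 := 6 \sum_{n=1}^{\infty} n^{-2}$, and define $c : \mathbb{C} \to \mathbb{C}$ by $$c(z) := 1 - 2 \pi^2 \, g\big(z/(2\pi)\big).$$ Then $c$ is an entire function with period $2\pi$, it satisfies the initial value problem $$c'' + c = 0, \qquad c(0) = 1, \qquad c'(0) = 0,$$ and for every $z \in \mathbb{C}$ $$c(z) = \sum_{n=0}^{\infty} (-1)^n \frac{z^{2n}}{(2n)!},$$ so that $c$ is precisely the cosine function.
   Context: The series defining $f$ converges normally on $\mathbb{C} \setminus \mathbb{Z}$, so $f$ is holomorphic there; it is meromorphic on $\mathbb{C}$ with a double pole at each integer, and it is nowhere zero on $\mathbb{C}\setminus\mathbb{Z}$. Hence $g = 1/f$, defined as $1/f(z)$ for $z \in \mathbb{C}\setminus\mathbb{Z}$ and as $0$ at each integer, is an entire function with a double zero at each integer. Here $\pi$ is defined only as the positive square root of $6\sum_{n=1}^\infty n^{-2}$; its ordinary meaning is not presupposed. *)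

(* Defs.v *)
(* MathComp-Analysis, over an arbitrary realType R. *)
From HB Require Import structures.
From mathcomp Require Import all_boot all_order all_algebra.
From mathcomp Require Import all_classical all_reals all_analysis.
From mathcomp Require Import summability.
From mathcomp.real_closed Require Import complex.

Set Implicit Arguments.
Unset Strict Implicit.
Unset Printing Implicit Defensive.

Import Order.TTheory GRing.Theory Num.Theory.
Import numFieldNormedType.Exports.

Local Open Scope classical_set_scope.
Local Open Scope ring_scope.

(* R[i] has no topology of its own; packed as a numClosedFieldType it inherits
   the one given by the modulus, as a normed space over itself, so that
   [derivable] and [derive1] on it are complex differentiability and the
   complex derivative. *)
Definition Cplx (R : realType) : numClosedFieldType := R[i].

Definition ofreal (R : realType) (x : R) : Cplx R := (x%:C)%C.

Definition entire (R : realType) (h : Cplx R -> Cplx R) : Prop :=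
  forall z, derivable h z 1.

Definition integers (R : realType) : set (Cplx R) := range intr.

(* [sum] is the unconditional sum: the limit of the sums over the finite
   subsets of int, directed by inclusion. [eis_f] is meant off the integers;
   its values there (where 1 / 0 = 0) are never used. *)
Definition eis_f (R : realType) (z : Cplx R) : Cplx R :=
  sum (fun n : int => 1 / (z - n%:~R) ^+ 2).

Definition eis_g (R : realType) (z : Cplx R) : Cplx R :=
  if z \in @integers R then 0 else 1 / eis_f z.

(* Not [trigo.pi]. *)
Definition eis_pi (R : realType) : R :=
  Num.sqrt (6 * limn (fun N => \sum_(1 <= n < N) (1 / n%:R ^+ 2 : R))).

Definition eis_c (R : realType) (z : Cplx R) : Cplx R :=
  1 - 2 * ofreal (eis_pi R) ^+ 2 * eis_g (z / (2 * ofreal (eis_pi R))).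

Definition ccos (R : realType) (z : Cplx R) : Cplx R :=
  limn (series (fun n => (-1) ^+ n * (z ^+ (2 * n) / (2 * n)`!%:R))).

(* Main.v *)
Require Import Defs.
From mathcomp Require Import all_boot all_order all_algebra.
From mathcomp Require Import all_classical all_reals all_analysis.
From mathcomp Require Import finmap summability ring lra zify.
From mathcomp.real_closed Require Import complex.

Import Order.TTheory GRing.Theory Num.Theory.
Import numFieldNormedType.Exports.

Local Open Scope classical_set_scope.
Local Open Scope ring_scope.

(** The function [eis_c] is the cosine because

      sum over n in Z of 1 / (z - n)^2  =  pi^2 / sin^2 (pi z)

    off the integers, where pi is half the period of the cosine: then
    1 - 2 pi^2 g (z / (2 pi)) = 1 - 2 sin^2 (z / 2) = cos z, and period,
    differential equation and power series are those of the cosine.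

    The expansion is proved by an explicit form of Herglotz' argument.  The
    function H z = pi^2 / sin^2 (pi z) ([cosec2]) satisfies
    4 H (z) = H (z / 2) + H ((z + 1) / 2) ([cosec2_dup]).  Iterating this k
    times ([cosec2_iter]) and using the period 1 of H, 4^k H (z) is the sum of
    the values H (w) over the 2^k points w = (z + j) / 2^k with
    -2^(k-1) <= j < 2^(k-1), whose real parts are at most about 1/2 in absolute
    value and whose imaginary parts are close to 0.  On that region
    H (w) - 1 / w^2 is bounded ([cosec2_pole]), and replacing each H (w) by
    1 / w^2 turns the sum into 4^k times the part of the series over a window of
    2^k integers around 0, with a total error of at most a constant times 2^k.
    So the sums over these windows converge to H (z) with rate 2^-k
    ([cosec2_dyadic]).  Any finite set of integers that contains a window
    differs from it by terms of size O(1 / n^2), whose sum is controlled by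
    telescoping ([sum_sqrV_tail]); this gives the unconditional sum
    ([cvg_partial_sum_cosec2]).

    At z = 1/2 the windows are combinations of the partial sums of 1 / n^2, and
    their limit says pi^2 = 6 zeta (2) ([zeta2E]), which identifies [eis_pi]
    with pi.

    The complex exponential is e^x (cos y + i sin y).  Its analytic input is a
    Taylor estimate ([cexp_taylor]), obtained along the segment from 0 to z from
    a bound for real functions; complex differentiability, the power series and
    the behaviour of sin near 0 are all read off from it. *)

Set Implicit Arguments.
Unset Strict Implicit.

(** * A Taylor bound for real functions *)

Lemma is_derive_expn_fact (R : realType) (m : nat) (s : R) :
  is_derive s 1 (fun x : R => x ^+ m.+1 / m.+1`!%:R) (s ^+ m / m`!%:R).
Proof.
have -> : (fun x : R => x ^+ m.+1 / m.+1`!%:R)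
          = (m.+1`!%:R)^-1 \*: (id ^+ m.+1).
  by apply/funext => x /=; rewrite mulrC exprfctE.
apply: is_derive_eq.
rewrite factS natrM /GRing.scale /= mulr1.
have ? : m.+1%:R != 0 :> R by rewrite pnatr_eq0.
have ? : m`!%:R != 0 :> R by rewrite pnatr_eq0 -lt0n fact_gt0.
by rewrite invfM mulrACA [_^-1 * _]mulrC divff // mul1r mulrC.
Qed.

(** If D' is dominated by G', then G - D and G + D are nondecreasing. *)
Lemma is_derive_le (R : realType) (D G dD dG : R -> R) (t : R) :
  (forall s : R, is_derive s 1 D (dD s)) -> (forall s : R, is_derive s 1 G (dG s)) ->
  D 0 = 0 -> G 0 = 0 -> 0 <= t ->
  (forall s : R, 0 <= s <= t -> `|dD s| <= dG s) -> `|D t| <= G t.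
Proof.
move=> dDP dGP D0 G0 t0 le.
suff mono (F dF : R -> R) : (forall s : R, is_derive s 1 F (dF s)) -> F 0 = 0 ->
    (forall s : R, 0 <= s <= t -> 0 <= dF s) -> 0 <= F t.
  rewrite ler_norml -subr_ge0 opprK; apply/andP; split.
    apply: (mono (D + G) (fun s => dD s + dG s)) => [|s /le].
    - by rewrite -[LHS]/(D 0 + G 0) D0 G0 addr0.
    - by rewrite ler_norml; lra.
  rewrite -subr_ge0; apply: (mono (G - D) (fun s => dG s - dD s)) => [|s /le].
  - by rewrite -[LHS]/(G 0 - D 0) D0 G0 subrr.
  - by rewrite ler_norml; lra.
move=> dFP F0 dF0; rewrite -F0.
have dF1 x : derivable F x 1 by case: (dFP x).
apply: (@ger0_derive1_le R F 0 t _ _ true false) => //.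
- move=> x; rewrite in_itv /= derive1E => /andP[/ltW x0 /ltW xt].
  by have [_ ->] := dFP x; apply: dF0; rewrite x0.
- apply: derivable_within_continuous => x _; exact: dF1.
- by rewrite in_itv /= lexx.
- by rewrite in_itv /= lexx t0.
Qed.

(** The [h k] are the successive derivatives of [h 0].  Each induction step
    integrates the estimate of one order for [h k.+1], by [is_derive_le]; this
    is why the bound is proved for all [k] at once. *)
Lemma taylor_bound (R : realType) (h : nat -> R -> R) (M K : R) :
  (forall k (t : R), is_derive t 1 (h k) (h k.+1 t)) ->
  (forall k (t : R), 0 <= t <= 1 -> `|h k t| <= M * K ^+ k) ->
  forall n k (t : R), 0 <= t <= 1 ->
  `|h k t - \sum_(j < n) h (k + j)%N 0 * (t ^+ j / j`!%:R)|
    <= M * K ^+ (k + n) * (t ^+ n / n`!%:R).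
Proof.
move=> dh bh; elim=> [|n IH] k t /andP[t0 t1].
  rewrite big_ord0 subr0 expr0 fact0 divr1 mulr1 addn0.
  by apply: bh; rewrite t0.
apply: (@is_derive_le R
  (fun s => h k s - \sum_(j < n.+1) h (k + j)%N 0 * (s ^+ j / j`!%:R))
  (fun s => M * K ^+ (k + n.+1) * (s ^+ n.+1 / n.+1`!%:R))
  (fun s => h k.+1 s - \sum_(j < n) h (k.+1 + j)%N 0 * (s ^+ j / j`!%:R))
  (fun s => M * K ^+ (k.+1 + n) * (s ^+ n / n`!%:R))) => //.
- move=> s.
  have -> : (fun s : R => h k s -
       \sum_(j < n.+1) h (k + j)%N 0 * (s ^+ j / j`!%:R)) = 
    h k - (cst (h k 0) + \sum_(j < n) h (k.+1 + j)%N 0 \*: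
             (fun x : R => x ^+ j.+1 / j.+1`!%:R)).
    apply/funext => x; rewrite big_ord_recl addn0 expr0 fact0 divr1 mulr1 /=.
    congr (_ - (_ + _)); rewrite fct_sumE; apply: eq_bigr => j _.
    by rewrite /= addSnnS.
  apply: is_deriveB; apply: is_derive_eq; last exact: add0r.
  apply: is_deriveD; apply: is_derive_sum => i.
  apply: is_deriveZ; exact: is_derive_expn_fact.
- move=> s; rewrite addSnnS.
  have -> : (fun s : R => M * K ^+ (k + n.+1) * (s ^+ n.+1 / n.+1`!%:R)) =
      (M * K ^+ (k + n.+1)) \*: (fun x : R => x ^+ n.+1 / n.+1`!%:R) by [].
  apply: is_deriveZ; exact: is_derive_expn_fact.
- rewrite big_ord_recl addn0 expr0 fact0 divr1 mulr1 big1 ?addr0 ?subrr // => j _.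
  by rewrite /= expr0n /= mul0r mulr0.
- by rewrite expr0n mul0r mulr0.
- move=> s /andP[s0 st]; apply: IH; rewrite s0; exact: le_trans t1.
Qed.

(** * The real-valued modulus *)

(** The norm of [Cplx R] takes its values in [Cplx R], whose order is only
    partial; estimates are carried out with this real-valued version, where
    linear arithmetic is available. *)
Definition modulus (R : realType) (z : Cplx R) : R := Normc.normc z.

Section modulus_theory.
Variable R : realType.
Implicit Types (z w : Cplx R) (x y : R).

Lemma norm_modulus z : `|z| = ofreal (modulus z).
Proof. by case: z. Qed.

Lemma ofreal_inj : injective (@ofreal R).
Proof. by move=> x y []. Qed.

Lemma ler_ofreal x y : (ofreal x <= ofreal y) = (x <= y).
Proof. exact: lecR. Qed.

Lemma ltr_ofreal x y : (ofreal x < ofreal y) = (x < y).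
Proof. exact: ltcR. Qed.

Lemma ofrealD x y : ofreal (x + y) = ofreal x + ofreal y.
Proof. exact: (rmorphD (real_complex R)). Qed.

Lemma ofrealM x y : ofreal (x * y) = ofreal x * ofreal y.
Proof. exact: (rmorphM (real_complex R)). Qed.

Lemma ofrealN x : ofreal (- x) = - ofreal x.
Proof. exact: (rmorphN (real_complex R)). Qed.

Lemma ofrealV x : ofreal (x^-1) = (ofreal x)^-1.
Proof. exact: (fmorphV (real_complex R)). Qed.

Lemma ofreal_nat n : ofreal (n%:R : R) = n%:R.
Proof. exact: (rmorph_nat (real_complex R)). Qed.

Lemma ofreal_int n : ofreal (n%:~R : R) = n%:~R.
Proof. exact: (rmorph_int (real_complex R)). Qed.

Lemma ofrealX x n : ofreal (x ^+ n) = ofreal x ^+ n.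
Proof. exact: (rmorphXn (real_complex R)). Qed.

Lemma modulus_ge0 z : 0 <= modulus z.
Proof. by case: z => a b; rewrite /modulus /= sqrtr_ge0. Qed.

Lemma modulus_ofreal x : modulus (ofreal x) = `|x|.
Proof. by rewrite /modulus /= expr0n /= addr0 sqrtr_sqr. Qed.

Lemma modulus_nat n : modulus (n%:R : Cplx R) = n%:R.
Proof. by rewrite -ofreal_nat modulus_ofreal normr_nat. Qed.

Lemma modulus0 : modulus (0 : Cplx R) = 0.
Proof. exact: (modulus_nat 0). Qed.

Lemma modulus1 : modulus (1 : Cplx R) = 1.
Proof. exact: (modulus_nat 1). Qed.

Lemma modulus_eq0 z : (modulus z == 0) = (z == 0).
Proof.
apply/eqP/eqP => [h|->]; last exact: modulus0.
by apply: normr0_eq0; rewrite norm_modulus h.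
Qed.

Lemma modulus_gt0 z : (0 < modulus z) = (z != 0).
Proof. by rewrite lt_def modulus_ge0 andbT modulus_eq0. Qed.

Lemma modulusM z w : modulus (z * w) = modulus z * modulus w.
Proof. exact: Normc.normcM. Qed.

Lemma modulusV z : modulus z^-1 = (modulus z)^-1.
Proof. exact: Normc.normcV. Qed.

Lemma modulusX z n : modulus (z ^+ n) = modulus z ^+ n.
Proof.
by elim: n => [|n IH]; rewrite ?expr0 ?modulus1 // !exprS modulusM IH.
Qed.

Lemma modulusN z : modulus (- z) = modulus z.
Proof. exact: normcN. Qed.

Lemma modulusD z w : modulus (z + w) <= modulus z + modulus w.
Proof. exact: le_normcD. Qed.

Lemma modulusB z w : modulus (z - w) <= modulus z + modulus w.
Proof. by rewrite -(modulusN w) modulusD. Qed.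

Lemma modulusB_ge z w : modulus z - modulus w <= modulus (z - w).
Proof. by rewrite lerBlDr (le_trans _ (modulusD _ _)) ?subrK. Qed.

Lemma modulus_distC z w : modulus (z - w) = modulus (w - z).
Proof. by rewrite -modulusN opprB. Qed.

Lemma modulus_sum (I : Type) (s : seq I) (P : pred I) (F : I -> Cplx R) :
  modulus (\sum_(i <- s | P i) F i) <= \sum_(i <- s | P i) modulus (F i).
Proof.
elim/big_rec2: _ => [|i x z _ h]; first by rewrite modulus0.
by rewrite (le_trans (modulusD _ _)) // lerD2l.
Qed.

Lemma sqr_modulus z : modulus z ^+ 2 = complex.Re z ^+ 2 + complex.Im z ^+ 2.
Proof. by case: z => a b; rewrite /modulus sqr_sqrtr ?addr_ge0 ?sqr_ge0. Qed.

Lemma Re_le_modulus z : `|complex.Re z| <= modulus z.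
Proof. 
rewrite -(@ler_pXn2r _ 2) ?nnegrE ?modulus_ge0 //.
by rewrite sqr_modulus real_normK ?num_real // lerDl sqr_ge0.
Qed.

Lemma Im_le_modulus z : `|complex.Im z| <= modulus z.
Proof. 
rewrite -(@ler_pXn2r _ 2) ?nnegrE ?modulus_ge0 //.
by rewrite sqr_modulus real_normK ?num_real // lerDr sqr_ge0.
Qed.

Lemma cvg_modulus (T : Type) (F : set_system T) (FF : Filter F)
    (f : T -> Cplx R) (l : Cplx R) :
  (forall e : R, 0 < e -> \forall t \near F, modulus (l - f t) <= e) ->
  f @ F --> l.
Proof.
move=> h; apply/cvgrPdist_le => e e0.
have [r re] : exists r : R, e = ofreal r.
  by exists (complex.Re e); case: e e0 => a b /andP[/= /eqP -> _].
rewrite re in e0 *.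
have r0 : 0 < r by move: e0; rewrite [_ < _]ltcR.
by have := h _ r0; apply: filterS => t; rewrite norm_modulus ler_ofreal.
Qed.

(** A first-order expansion with a quadratic error determines the derivative:
    the difference quotient is within [C * modulus h] of [d]. *)
Lemma is_derive_quad (f : Cplx R -> Cplx R) (z d : Cplx R) (C : R) :
  (forall h, modulus h <= 1 ->
     modulus (f (z + h) - f z - h * d) <= C * modulus h ^+ 2) ->
  is_derive z 1 f d.
Proof.
move=> hf.
have C0 : 0 <= C.
  have := hf 1; rewrite modulus1 expr1n mulr1 => /(_ (lexx _)).
  exact: le_trans (modulus_ge0 _).
have H : (fun h : Cplx R => h^-1 *: ((f \o shift z) (h *: (1 : Cplx R)) - f z))
    @ 0^' --> d.
  apply: cvg_modulus => e e0.
  pose r := Num.min 1 (e / (C + 1)).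
  have r0 : 0 < r by rewrite lt_min ltr01 divr_gt0 // ltr_wpDl.
  near=> h.
  have h0 : h != 0 by near: h; exact: nbhs_dnbhs_neq.
  have hr : modulus h < r.
    rewrite -ltr_ofreal -norm_modulus.
    by near: h; apply: dnbhs0_lt; rewrite -[0]/(ofreal 0) ltr_ofreal.
  have /andP[h1 he] : (modulus h <= 1) && (modulus h <= e / (C + 1)).
    by rewrite -le_min ltW.
  have hn : 0 < modulus h by rewrite modulus_gt0.
  rewrite /= [h *: _]mulr1 (addrC h).
  have key (a b : Cplx R) : d - h^-1 * (a - b) = - (h^-1 * (a - b - h * d)).
    by field.
  rewrite [X in modulus X](_ : _ = - (h^-1 * (f (z + h) - f z - h * d)));
    last exact: key.
  rewrite modulusN modulusM modulusV.
  rewrite (@le_trans _ _ ((modulus h)^-1 * (C * modulus h ^+ 2))) //.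
    by rewrite ler_wpM2l ?invr_ge0 ?modulus_ge0 // hf.
  have -> : (modulus h)^-1 * (C * modulus h ^+ 2) = C * modulus h.
    by field; rewrite gt_eqF.
  rewrite (@le_trans _ _ ((C + 1) * (e / (C + 1)))) //.
    by apply: ler_pM => //; [exact: modulus_ge0|rewrite lerDl].
  by rewrite mulrC divfK // gt_eqF // ltr_wpDl.
by split; [apply/cvg_ex; exists d|apply: cvg_lim].
Unshelve. all: by end_near. Qed.

End modulus_theory.

(** * The complex exponential *)

Definition cexp (R : realType) (z : Cplx R) : Cplx R :=
  (expR (complex.Re z) * cos (complex.Im z)
   +i* (expR (complex.Re z) * sin (complex.Im z)))%C.

Section cexp_theory.
Variable R : realType.
Implicit Types (z w : Cplx R) (x y : R).

Lemma cexp0 : cexp (0 : Cplx R) = 1.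
Proof. by rewrite /cexp /= expR0 cos0 sin0 mulr1 mulr0. Qed.

Lemma cexpD z w : cexp (z + w) = cexp z * cexp w.
Proof.
case: z w => [a b] [c d]; apply/eqP; rewrite eq_complex /= expRD cosD sinD.
by apply/andP; split; apply/eqP; ring.
Qed.

Lemma modulus_cexp z : modulus (cexp z) = expR (complex.Re z).
Proof.
apply/eqP; rewrite -(@eqrXn2 _ 2) ?modulus_ge0 ?expR_ge0 // sqr_modulus /=.
by rewrite !exprMn -mulrDr cos2Dsin2 mulr1.
Qed.

(** With z = a + i b, this is the derivative of Re ((p + i q) e^(s z)), which is
    Re ((p + i q) z e^(s z)). *)
Lemma is_derive_exp_cos_sin (a b p q t : R) :
  is_derive t 1 (fun s : R => expR (s * a) * (p * cos (s * b) - q * sin (s * b)))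
    (expR (t * a) * ((a * p - b * q) * cos (t * b)
                     - (a * q + b * p) * sin (t * b))).
Proof.
have lin (c : R) : is_derive t 1 (fun s : R => s * c) c.
  have -> : (fun s : R => s * c) = c \*: id by apply/funext => s /=; rewrite mulrC.
  by apply: is_derive_eq; rewrite /GRing.scale /= mulr1.
have e1 : is_derive t 1 (fun s : R => expR (s * a)) (expR (t * a) * a).
  exact: (@is_derive1_comp _ expR (fun s => s * a)).
have e2 : is_derive t 1 (fun s : R => cos (s * b)) (- sin (t * b) * b).
  exact: (@is_derive1_comp _ cos (fun s => s * b)).
have e3 : is_derive t 1 (fun s : R => sin (s * b)) (cos (t * b) * b).
  exact: (@is_derive1_comp _ sin (fun s => s * b)).
have -> : (fun s : R => expR (s * a) * (p * cos (s * b) - q * sin (s * b))) =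
  (fun s : R => expR (s * a)) *
     (p \*: (fun s : R => cos (s * b)) - q \*: (fun s : R => sin (s * b))).
  by [].
apply: is_derive_eq; rewrite /GRing.scale /=.
rewrite -[(_ - _ : R -> R) t]/(p * cos (t * b) - q * sin (t * b)).
ring.
Qed.

Lemma Re_ofrealM x z : complex.Re (ofreal x * z) = x * complex.Re z.
Proof. by case: z => a b /=; rewrite mul0r subr0. Qed.

Lemma Im_ofrealM x z : complex.Im (ofreal x * z) = x * complex.Im z.
Proof. by case: z => a b /=; rewrite mul0r addr0. Qed.

(** Let D be the remainder.  The real Taylor bound applies to the function
    t |-> Re (om e^(t z)) for any constant om; the choice om = conj D makes
    Re (om D) equal to |D|^2, so the real estimate loses no constant factor. *)
Lemma cexp_taylor z n :
  modulus (cexp z - \sum_(j < n) (z ^+ j / j`!%:R))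
    <= expR `|complex.Re z| * (modulus z ^+ n / n`!%:R).
Proof.
set D := cexp z - _.
have [->|D0] := eqVneq D 0.
  rewrite modulus0 mulr_ge0 ?expR_ge0 // divr_ge0 ?exprn_ge0 ?modulus_ge0 //.
pose om : Cplx R := conjc D.
have Mom : modulus om = modulus D.
  by rewrite /om; case: D {om D0} => a b; rewrite /modulus /= sqrrN.
have ReD : complex.Re (om * D) = modulus D ^+ 2.
  rewrite sqr_modulus /om; case: D {om Mom D0} => a b /=.
  by rewrite mulNr opprK !expr2.
pose h k t := complex.Re (om * z ^+ k * cexp (ofreal t * z)).
have dh k (t : R) : is_derive t 1 (h k) (h k.+1 t).
  have hE m s : h m s = expR (s * complex.Re z) *
     (complex.Re (om * z ^+ m) * cos (s * complex.Im z)
      - complex.Im (om * z ^+ m) * sin (s * complex.Im z)).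
    rewrite /h; case: (om * z ^+ m) => p q.
    by rewrite /cexp Re_ofrealM Im_ofrealM /=; ring.
  have -> : h k = fun s : R => expR (s * complex.Re z) *
     (complex.Re (om * z ^+ k) * cos (s * complex.Im z)
      - complex.Im (om * z ^+ k) * sin (s * complex.Im z)).
    by apply/funext => s; rewrite hE.
  rewrite hE exprSr mulrA.
  have mulE (u : Cplx R) :
    complex.Re (u * z) =
      complex.Re z * complex.Re u - complex.Im z * complex.Im u /\
    complex.Im (u * z) =
      complex.Re z * complex.Im u + complex.Im z * complex.Re u.
    by case: (z) => a b; case: u => p q /=; split; ring.
  have [-> ->] := mulE (om * z ^+ k).
  exact: is_derive_exp_cos_sin.
have bh k (t : R) : 0 <= t <= 1 ->
    `|h k t| <= modulus om * expR `|complex.Re z| * modulus z ^+ k.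
  move=> /andP[t0 t1]; apply: le_trans (Re_le_modulus _) _.
  rewrite !modulusM modulusX modulus_cexp Re_ofrealM mulrAC.
  rewrite ler_wpM2r ?exprn_ge0 ?modulus_ge0 // ler_wpM2l ?modulus_ge0 //.
  rewrite ler_expR (le_trans (ler_norm _)) // normrM ger0_norm //.
  by rewrite -[leRHS]mul1r ler_wpM2r.
have := taylor_bound dh bh n 0 (t := 1).
rewrite ler01 lexx => /(_ isT).
rewrite (_ : _ - _ = modulus D ^+ 2); last first.
  rewrite -ReD /D mulrBr raddfB /= /h expr0 mulr1 mul1r.
  congr (_ - _); rewrite mulr_sumr raddf_sum; apply: eq_bigr => j _ /=.
  rewrite mul0r cexp0 mulr1 expr1n -ofreal_nat -ofrealV mul1r.
  by rewrite mulrC -Re_ofrealM; congr complex.Re; ring.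
rewrite ger0_norm ?sqr_ge0 // Mom expr1n add0n expr2 mul1r -!mulrA.
by rewrite ler_pM2l // modulus_gt0.
Qed.

End cexp_theory.

(** * Complex sine and cosine *)

Definition iC (R : realType) : Cplx R := (0 +i* 1)%C.

Definition cosC (R : realType) (z : Cplx R) : Cplx R :=
  (cexp (iC R * z) + cexp (- (iC R * z))) / 2.

Definition sinC (R : realType) (z : Cplx R) : Cplx R :=
  (cexp (iC R * z) - cexp (- (iC R * z))) / (2 * iC R).

Section trig.
Variable R : realType.
Implicit Types (z w u : Cplx R) (x y : R).
Local Notation i := (iC R).

Lemma sqr_iC : i ^+ 2 = -1.
Proof. by apply/eqP; rewrite expr2 eq_complex /=; apply/andP; split; apply/eqP; ring. Qed.

Lemma iC_neq0 : i != 0.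
Proof. by rewrite eq_complex /= oner_eq0 andbF. Qed.

Lemma iCV : i^-1 = - i.
Proof.
by apply: (mulfI iC_neq0); rewrite mulfV ?iC_neq0 // mulrN -expr2 sqr_iC opprK.
Qed.

Lemma two_neq0 : (2 : Cplx R) != 0.
Proof. by rewrite pnatr_eq0. Qed.

Lemma modulus_iC : modulus i = 1.
Proof. by rewrite /modulus /= expr0n expr1n add0r sqrtr1. Qed.

Lemma cexpNM z : cexp z * cexp (- z) = 1.
Proof. by rewrite -cexpD subrr cexp0. Qed.

Lemma sinC_double u : sinC (2 * u) = 2 * sinC u * cosC u.
Proof.
rewrite /sinC /cosC.
have -> : i * (2 * u) = i * u + i * u by ring.
rewrite opprD !cexpD.
by field; rewrite iC_neq0.
Qed.

Lemma cosC_double u : cosC (2 * u) = 1 - 2 * sinC u ^+ 2.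
Proof.
rewrite /sinC /cosC.
have -> : i * (2 * u) = i * u + i * u by ring.
rewrite opprD !cexpD expr_div_n exprMn sqr_iC.
have := cexpNM (i * u); set a := cexp _; set b := cexp _ => ab.
have -> : a * a + b * b = (a - b) ^+ 2 + 2 * (a * b) by ring.
rewrite ab.
by field.
Qed.

Lemma cos2Dsin2C u : cosC u ^+ 2 + sinC u ^+ 2 = 1.
Proof.
rewrite /sinC /cosC !expr_div_n exprMn sqr_iC; apply: etrans (cexpNM (i * u)).
by field.
Qed.

Lemma iC_ofreal (x : R) : i * ofreal x = (0 +i* x)%C.
Proof. by apply/eqP; rewrite eq_complex /=; apply/andP; split; apply/eqP; ring. Qed.

Lemma cexp_pihalf : cexp (i * ofreal (pi / 2)) = i.
Proof. by rewrite iC_ofreal /cexp /= expR0 cos_pihalf sin_pihalf !mul1r. Qed.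

Lemma sinCDpihalf u : sinC (u + ofreal (pi / 2)) = cosC u.
Proof.
rewrite /sinC /cosC mulrDr opprD !cexpD cexp_pihalf.
have h : cexp (- (i * ofreal (pi / 2))) = - i.
  have := cexpNM (i * ofreal (pi / 2)); rewrite cexp_pihalf => h.
  by apply: (mulfI iC_neq0); rewrite h mulrN -expr2 sqr_iC opprK.
by rewrite h; field; rewrite iC_neq0.
Qed.

Lemma cosCDpihalf u : cosC (u + ofreal (pi / 2)) = - sinC u.
Proof.
rewrite /sinC /cosC mulrDr opprD !cexpD cexp_pihalf.
have h : cexp (- (i * ofreal (pi / 2))) = - i.
  have := cexpNM (i * ofreal (pi / 2)); rewrite cexp_pihalf => h.
  by apply: (mulfI iC_neq0); rewrite h mulrN -expr2 sqr_iC opprK.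
by rewrite h invfM iCV; field.
Qed.

Lemma ofreal_pi : ofreal (pi : R) = ofreal (pi / 2) + ofreal (pi / 2).
Proof. by rewrite -ofrealD -splitr. Qed.

Lemma sinCDpi u : sinC (u + ofreal pi) = - sinC u.
Proof. by rewrite ofreal_pi addrA sinCDpihalf cosCDpihalf. Qed.

Lemma cosCDpi u : cosC (u + ofreal pi) = - cosC u.
Proof. by rewrite ofreal_pi addrA cosCDpihalf sinCDpihalf. Qed.

Lemma cosCD2pi z : cosC (z + 2 * ofreal pi) = cosC z.
Proof. by rewrite mulr_natl mulr2n addrA !cosCDpi opprK. Qed.

Lemma cosC0 : cosC (0 : Cplx R) = 1.
Proof. by rewrite /cosC mulr0 oppr0 cexp0 divff // two_neq0. Qed.

Lemma sinC0 : sinC (0 : Cplx R) = 0.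
Proof. by rewrite /sinC mulr0 oppr0 cexp0 subrr mul0r. Qed.

Lemma sinC_pihalf : sinC (ofreal (pi / 2) : Cplx R) = 1.
Proof. by rewrite -[ofreal _]add0r sinCDpihalf cosC0. Qed.

(** e^(a (z + h)) - e^(a z) - h a e^(a z) is e^(a z) times the second-order
    Taylor remainder of e^(a h). *)
Lemma is_derive_cexpM (a z : Cplx R) :
  is_derive z 1 (fun w => cexp (a * w)) (a * cexp (a * z)).
Proof.
apply: (@is_derive_quad _ _ _ _ 
  (modulus (cexp (a * z)) * (expR (modulus a) * (modulus a ^+ 2 / 2)))).
move=> h h1; rewrite mulrDr cexpD.
rewrite (_ : _ - _ - _ = cexp (a * z) *
   (cexp (a * h) - \sum_(j < 2) ((a * h) ^+ j / j`!%:R))); last first.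
  rewrite !big_ord_recl big_ord0 /= /bump /= !fact0 expr0 expr1.
  by rewrite (_ : (1 + 0)`! = 1)%N // !divr1; ring.
rewrite modulusM -[leRHS]mulrA ler_wpM2l ?modulus_ge0 //.
apply: le_trans (cexp_taylor _ _) _.
have -> : expR (modulus a) * (modulus a ^+ 2 / 2) * modulus h ^+ 2 =
    expR (modulus a) * (modulus (a * h) ^+ 2 / 2`!%:R).
  by rewrite modulusM [2`!](_ : _ = 2%N) //; field.
rewrite ler_wpM2r ?divr_ge0 ?exprn_ge0 ?modulus_ge0 //.
rewrite ler_expR (le_trans (Re_le_modulus _)) // modulusM.
by rewrite -[leRHS]mulr1 ler_wpM2l // modulus_ge0.
Qed.

Lemma is_derive_cosC z : is_derive z 1 (@cosC R) (- sinC z).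
Proof.
have -> : @cosC R = 2^-1 \*: ((fun w => cexp (i * w)) + (fun w => cexp (- i * w))).
  apply/funext => w; rewrite -[RHS]/(2^-1 * (cexp (i * w) + cexp (- i * w))).
  by rewrite /cosC mulNr mulrC.
have d1 := is_derive_cexpM i z.
have d2 := is_derive_cexpM (- i) z.
apply: is_derive_eq; rewrite /sinC -(mulNr i z).
have E (a b : Cplx R) : 2^-1 * (i * a + (- i) * b) = - ((a - b) / (2 * i)).
  by rewrite invfM iCV; field.
exact: E.
Qed.

Lemma is_derive_sinC z : is_derive z 1 (@sinC R) (cosC z).
Proof.
have -> : @sinC R =
    (2 * i)^-1 \*: ((fun w => cexp (i * w)) - (fun w => cexp (- i * w))).
  apply/funext => w.
  rewrite -[RHS]/((2 * i)^-1 * (cexp (i * w) - cexp (- i * w))).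
  by rewrite /sinC mulNr mulrC.
have d1 := is_derive_cexpM i z.
have d2 := is_derive_cexpM (- i) z.
apply: is_derive_eq; rewrite /cosC -(mulNr i z).
have E (a b : Cplx R) : (2 * i)^-1 * (i * a - (- i) * b) = (a + b) / 2.
  by field; rewrite iC_neq0.
exact: E.
Qed.

Lemma Re_iCM z : complex.Re (i * z) = - complex.Im z.
Proof. by case: z => a b /=; rewrite mul0r mul1r sub0r. Qed.

Lemma ReN z : complex.Re (- z) = - complex.Re z.
Proof. by case: z. Qed.

(** The quadratic terms of e^(i u) and e^(- i u) cancel, so 2 i (sin u - u) is
    the difference of their two third-order remainders. *)
Lemma sinC_taylor u :
  modulus (sinC u - u) <= expR `|complex.Im u| * (modulus u ^+ 3 / 6).
Proof.
pose T z := \sum_(j < 3) (z ^+ j / j`!%:R : Cplx R).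
have -> : sinC u - u =
    ((cexp (i * u) - T (i * u)) - (cexp (- (i * u)) - T (- (i * u)))) / (2 * i).
  rewrite /sinC /T !big_ord_recl !big_ord0 /= /bump /=.
  rewrite (_ : (1 + 0)`! = 1)%N // (_ : (1 + (1 + 0))`! = 2)%N // fact0.
  by field; rewrite iC_neq0.
have B (s : Cplx R) : modulus s = modulus u ->
    `|complex.Re s| = `|complex.Im u| ->
    modulus (cexp s - T s) <= expR `|complex.Im u| * (modulus u ^+ 3 / 6).
  by move=> su sI; apply: le_trans (cexp_taylor _ 3) _; rewrite su sI.
rewrite modulusM modulusV modulusM modulus_nat modulus_iC mulr1.
rewrite ler_pdivrMr ?ltr0n // mulr_natr mulr2n.
apply: le_trans (modulusB _ _) _; apply: lerD; apply: B.
- by rewrite modulusM modulus_iC mul1r.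
- by rewrite Re_iCM normrN.
- by rewrite modulusN modulusM modulus_iC mul1r.
- by rewrite ReN Re_iCM opprK.
Qed.

(** The odd powers cancel and the even ones agree. *)
Lemma sum_cos_terms z n :
  \sum_(j < 2 * n) ((i * z) ^+ j / j`!%:R)
    + \sum_(j < 2 * n) ((- (i * z)) ^+ j / j`!%:R)
  = 2 * series (fun k => (-1) ^+ k * (z ^+ (2 * k) / (2 * k)`!%:R)) n.
Proof.
elim: n => [|n IH]; first by rewrite muln0 !big_ord0 /series /= big_geq ?addr0 ?mulr0.
rewrite mulnS addSn add1n !big_ord_recr /= /series /= big_nat_recr //=.
rewrite mulrDr -IH.
set A := \sum_(j < _) _; set B := \sum_(j < _) _.
have -> : (i * z) ^+ (2 * n) = (-1) ^+ n * z ^+ (2 * n).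
  by rewrite exprMn exprM sqr_iC.
have -> : (- (i * z)) ^+ (2 * n) = (-1) ^+ n * z ^+ (2 * n).
  by rewrite exprM sqrrN -exprM exprMn exprM sqr_iC.
have -> : (- (i * z)) ^+ (2 * n).+1 = - (i * z) ^+ (2 * n).+1.
  by rewrite exprNn -signr_odd /= mul2n odd_double mulN1r.
ring.
Qed.

Lemma cvg_cosC z :
  series (fun k => (-1) ^+ k * (z ^+ (2 * k) / (2 * k)`!%:R)) @ \oo --> cosC z.
Proof.
apply: cvg_modulus => e e0.
have M0 : 0 < expR (modulus z) by exact: expR_gt0.
have T0 : exp_coeff (modulus z) @ \oo --> 0.
  by apply: cvg_series_cvg_0; exact: is_cvg_series_exp_coeff.
have /cvgrPdist_le /(_ (e / expR (modulus z))) := T0.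
rewrite divr_gt0 // => /(_ isT) [N _ HN].
near=> n.
have Nn : (N <= 2 * n)%N by rewrite mul2n -addnn; apply: leq_trans (leq_addr _ _); near: n; exists N.
pose T s := \sum_(j < 2 * n) (s ^+ j / j`!%:R : Cplx R).
have -> : cosC z - series (fun k => (-1) ^+ k * (z ^+ (2 * k) / (2 * k)`!%:R)) n
  = ((cexp (i * z) - T (i * z)) + (cexp (- (i * z)) - T (- (i * z)))) / 2.
  have := sum_cos_terms z n; rewrite -/(T _) -/(T _).
  set S := series _ _ => h.
  have -> : S = (T (i * z) + T (- (i * z))) / 2 by rewrite h; field.
  by rewrite /cosC; field.
have := HN _ Nn; rewrite /exp_coeff /= sub0r normrN ger0_norm; last first.
  by rewrite divr_ge0 ?exprn_ge0 ?modulus_ge0.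
rewrite ler_pdivlMr // mulrC => h.
have B (s : Cplx R) : modulus s = modulus z -> modulus (cexp s - T s) <= e.
  move=> su; apply: le_trans (cexp_taylor _ _) _; apply: le_trans h; rewrite su.
  rewrite ler_wpM2r ?divr_ge0 ?exprn_ge0 ?modulus_ge0 // ler_expR -su.
  exact: Re_le_modulus.
rewrite modulusM modulusV modulus_nat ler_pdivrMr ?ltr0n // mulr_natr mulr2n.
apply: le_trans (modulusD _ _) _; apply: lerD; apply: B.
- by rewrite modulusM modulus_iC mul1r.
- by rewrite modulusN modulusM modulus_iC mul1r.
Unshelve. all: by end_near. Qed.

End trig.

(** * The duplication formula and its iteration *)

(** pi^2 / sin^2 (pi z); it takes the value 0 at the integers, where it divides
    by 0. *)
Definition cosec2 (R : realType) (z : Cplx R) : Cplx R :=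
  (ofreal pi / sinC (ofreal pi * z)) ^+ 2.

Section herglotz.
Variable R : realType.
Implicit Types (z w u : Cplx R) (x y : R).

Lemma ofreal_pi_neq0 : ofreal (pi : R) != 0.
Proof. by rewrite -modulus_eq0 modulus_ofreal normr_eq0 gt_eqF // pi_gt0. Qed.

Lemma cosec2Dint z (n : int) : cosec2 (z + n%:~R) = cosec2 z.
Proof.
have D1 w : cosec2 (w + 1) = cosec2 w.
  by rewrite /cosec2 mulrDr mulr1 sinCDpi invrN mulrN sqrrN.
have Dn (m : nat) w : cosec2 (w + m%:R) = cosec2 w.
  by elim: m => [|m IH]; rewrite ?addr0 // -natr1 addrA D1 IH.
case: n => m; first exact: Dn.
by rewrite NegzE rmorphN /= -[in RHS](subrK (m.+1%:R) z) Dn.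
Qed.

Lemma pi_lt4 : pi < 4 :> R.
Proof. by have := @pihalf_lt2 R; lra. Qed.

(** The region of [modulus w] at most 51/100 and imaginary part at most 1/20
    contains the points (z + j) / 2^k with -2^(k-1) <= j < 2^(k-1) for large
    [k].  It is small enough for the cubic Taylor bound to keep sin away
    from 0, using only pi < 4. *)
Lemma sinC_taylor_pi w : modulus w <= 51 / 100 -> `|complex.Im w| <= 1 / 20 ->
  modulus (sinC (ofreal pi * w) - ofreal pi * w)
    <= 5 / 24 * modulus (ofreal pi * w) ^+ 3.
Proof.
move=> w1 w2; apply: le_trans (sinC_taylor _) _.
have pi0 := @pi_gt0 R; have pi4 := pi_lt4.
rewrite Im_ofrealM normrM (ger0_norm (ltW pi0)).
(* The exponent t is at most 1/5, and e^t <= 1 / (1 - t). *)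
have e1 : expR (pi * `|complex.Im w|) <= 5 / 4.
  have h : 4 / 5 <= expR (- (pi * `|complex.Im w|)).
    apply: le_trans (expR_ge1Dx _).
    suff : pi * `|complex.Im w| <= 4 * (1 / 20) by lra.
    by apply: ler_pM => //; exact: ltW.
  rewrite expRN in h.
  rewrite -[leLHS]invrK -[leRHS]invrK lef_pV2 ?posrE ?invr_gt0 ?expR_gt0 //.
  by rewrite invf_div.
have -> : 5 / 24 * modulus (ofreal pi * w) ^+ 3 =
    5 / 4 * (modulus (ofreal pi * w) ^+ 3 / 6) by field.
by rewrite ler_wpM2r // divr_ge0 // exprn_ge0 // modulus_ge0.
Qed.

Lemma modulus_piM w : modulus w <= 51 / 100 ->
  modulus (ofreal pi * w) ^+ 2 <= 21 / 5.
Proof.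
move=> w1; have pi0 := @pi_gt0 R; have pi4 := pi_lt4.
rewrite modulusM modulus_ofreal (ger0_norm (ltW pi0)).
rewrite (@le_trans _ _ ((4 * (51 / 100)) ^+ 2)) //; last lra.
rewrite ler_pXn2r ?nnegrE ?mulr_ge0 ?modulus_ge0 ?(ltW pi0) //.
by apply: ler_pM; rewrite ?modulus_ge0 // ltW.
Qed.

(** With u = pi w, the cubic error 5/24 |u|^3 is at most 7/8 |u|, because
    |u|^2 <= 21/5. *)
Lemma sinC_lower w : modulus w <= 51 / 100 -> `|complex.Im w| <= 1 / 20 ->
  modulus (ofreal pi * w) <= 10 * modulus (sinC (ofreal pi * w)).
Proof.
move=> w1 w2; have := sinC_taylor_pi w1 w2.
have := modulusB_ge (ofreal pi * w) (sinC (ofreal pi * w)).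
rewrite modulus_distC; set a := modulus (_ - _).
have := modulus_piM w1; have := modulus_ge0 (ofreal pi * w).
set m := modulus (ofreal pi * w) => m0 m2 h1 h2.
have : 0 <= m * (21 / 5 - m ^+ 2) by rewrite mulr_ge0 // subr_ge0.
nra.
Qed.

Lemma ofreal_ReIm z : complex.Im z = 0 -> z = ofreal (complex.Re z).
Proof. by case: z => a b /= ->. Qed.

(** A zero u = pi w of sin has e^(i u) = e^(- i u); comparing moduli makes w
    real, and translating w by the nearest integer brings it to [-1/2, 1/2],
    where [sinC_lower] leaves only 0. *)
Lemma sinC_pi_eq0 w : sinC (ofreal pi * w) = 0 -> @integers R w.
Proof.
move=> /eqP; rewrite mulf_eq0 invr_eq0 mulf_eq0 (negbTE (two_neq0 R)).
rewrite (negbTE (iC_neq0 R)) !orbF subr_eq0 => /eqP h.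
have I0 : complex.Im w = 0.
  have := congr1 (@modulus R) h; rewrite !modulus_cexp ReN Re_iCM Im_ofrealM.
  move/expR_inj => e; have pi0 := @pi_gt0 R.
  have : pi * complex.Im w = 0 by lra.
  by move/eqP; rewrite mulf_eq0 gt_eqF //= => /eqP.
have /ofreal_ReIm wx := I0; set x := complex.Re w in wx.
pose n := Num.floor (x + 1 / 2).
pose r := w - n%:~R.
have rE : r = ofreal (x - n%:~R) by rewrite /r wx ofrealD ofrealN ofreal_int.
have r2 : `|x - n%:~R| <= 1 / 2.
  have := floor_itv (x + 1 / 2); rewrite -/n rmorphD /= => /andP[h1 h2].
  by rewrite ler_norml; apply/andP; split; lra.
have s0 : sinC (ofreal pi * r) = 0.
  have : cosec2 r = 0.
    rewrite /r -rmorphN cosec2Dint /cosec2 /sinC h subrr mul0r invr0 mulr0.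
    by rewrite expr0n.
  move=> /eqP; rewrite expf_eq0 /= mulf_eq0 (negbTE ofreal_pi_neq0) invr_eq0.
  by move=> /eqP.
have : modulus (ofreal pi * r) <= 10 * modulus (sinC (ofreal pi * r)).
  apply: sinC_lower; rewrite rE ?modulus_ofreal /=; first lra.
  by rewrite normr0; lra.
rewrite s0 modulus0 mulr0 le_eqVlt ltNge modulus_ge0 orbF modulus_eq0.
rewrite mulf_eq0 (negbTE ofreal_pi_neq0) /= subr_eq0 => /eqP ->.
by exists n.
Qed.

(** This is 1 / sin^2 + 1 / cos^2 = 4 / sin^2 of the double angle, as the shift
    of z / 2 by 1 / 2 turns sin (pi z / 2) into cos (pi z / 2). *)
Lemma cosec2_dup z : ~ @integers R z ->
  4 * cosec2 z = cosec2 (z / 2) + cosec2 ((z + 1) / 2).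
Proof.
move=> zZ; have /eqP s0 : sinC (ofreal pi * z) <> 0 by move/sinC_pi_eq0.
rewrite /cosec2.
have -> : ofreal pi * ((z + 1) / 2) = ofreal pi * (z / 2) + ofreal (pi / 2).
  by rewrite ofrealM ofrealV ofreal_nat; field.
have E : ofreal pi * z = 2 * (ofreal pi * (z / 2)) by field.
rewrite E in s0 *; rewrite sinC_double in s0 *; rewrite sinCDpihalf.
have := cos2Dsin2C (ofreal pi * (z / 2)).
move: s0; move: (ofreal pi * (z / 2)) => u; move: (ofreal pi) => p.
move: (sinC u) (cosC u) => s c h cs.
have s0 : s != 0 by apply: contraNneq h => ->; rewrite mulr0 mul0r.
have c0 : c != 0 by apply: contraNneq h => ->; rewrite mulr0.
transitivity (p ^+ 2 * (c ^+ 2 + s ^+ 2) / (s ^+ 2 * c ^+ 2)).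
  by rewrite cs; field; rewrite s0 c0.
by field; rewrite s0 c0.
Qed.

Lemma not_integer_shift_scale z (n : int) (k : nat) : ~ @integers R z ->
  ~ @integers R ((z + n%:~R) / 2 ^+ k).
Proof.
move=> zZ [m _ mE]; apply: zZ; exists (m * 2 ^+ k - n) => //.
by rewrite rmorphB rmorphM rmorphXn /= mE divfK ?addrK // expf_neq0 //.
Qed.

(** For w = (z + j) / 2^k, the points w / 2 and (w + 1) / 2 are those of index
    j and j + 2^k at the next level. *)
Lemma cosec2_iter z k : ~ @integers R z ->
  4 ^+ k * cosec2 z = \sum_(j < 2 ^ k) cosec2 ((z + j%:R) / 2 ^+ k).
Proof.
move=> zZ; elim: k => [|k IH].
  by rewrite big_ord_recl big_ord0 !expr0 mul1r divr1 addr0 addr0.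
rewrite exprS -mulrA IH mulr_sumr expnS mul2n -addnn big_split_ord /=.
rewrite -big_split /=; apply: eq_bigr => j _.
rewrite cosec2_dup; last first.
  exact: (@not_integer_shift_scale z j).
have k0 : (2 : Cplx R) ^+ k != 0 by rewrite expf_neq0 // two_neq0.
congr (_ + _); congr cosec2; rewrite exprS.
  by field.
by rewrite natrD natrX; field.
Qed.

(** With u = pi w and s = sin u, the difference is
    pi^2 (u - s) (u + s) / (s u)^2; the numerator is O(|u|^4) by the Taylor
    bound and |s u|^2 is at least |u|^4 / 100 by [sinC_lower]. *)
Lemma cosec2_pole w : w != 0 -> modulus w <= 51 / 100 ->
  `|complex.Im w| <= 1 / 20 ->
  modulus (cosec2 w - 1 / w ^+ 2) <= 1000.
Proof.
move=> w0 w1 w2; have pi0 := @pi_gt0 R; have pi4 := pi_lt4.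
have h1 := sinC_taylor_pi w1 w2; have h2 := sinC_lower w1 w2.
have h3 := modulus_piM w1.
have u0 : ofreal pi * w != 0 by rewrite mulf_neq0 // ofreal_pi_neq0.
have -> : 1 / w ^+ 2 = (ofreal pi / (ofreal pi * w)) ^+ 2.
  by rewrite [in RHS]invfM mulrA divff ?ofreal_pi_neq0 // expr_div_n expr1n.
rewrite /cosec2; move: h1 h2 h3 u0.
move: (ofreal pi * w) => u; move: (sinC u) => s h1 h2 h3 u0.
have m0 : 0 < modulus u by rewrite modulus_gt0.
have a0 : 0 < modulus s by rewrite -(pmulr_rgt0 _ (ltr0n _ 10)) (lt_le_trans m0).
have s0 : s != 0 by rewrite -modulus_gt0.
have -> : (ofreal pi / s) ^+ 2 - (ofreal pi / u) ^+ 2 =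
    ofreal pi ^+ 2 * ((u - s) * (u + s)) / (s * u) ^+ 2.
  by field; rewrite s0 u0.
have -> : modulus (ofreal pi ^+ 2 * ((u - s) * (u + s)) / (s * u) ^+ 2) =
    pi ^+ 2 * (modulus (u - s) * modulus (u + s)) / (modulus s * modulus u) ^+ 2.
  rewrite !(modulusX, modulusM, modulusV) modulus_ofreal (ger0_norm (ltW pi0)).
  by rewrite !expr2.
rewrite modulus_distC in h1.
rewrite ler_pdivrMr ?exprn_gt0 ?mulr_gt0 //.
have h4 : modulus (u + s) <= 3 * modulus u.
  have -> : u + s = (u + u) - (u - s) by ring.
  apply: le_trans (modulusB _ _) _; apply: le_trans (lerD (modulusD _ _) h1) _.
  have : 0 <= modulus u * (21 / 5 - modulus u ^+ 2).
    by rewrite mulr_ge0 ?subr_ge0 // ltW.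
  nra.
(* pi^2 <= 16, so the numerator is at most 10 |u|^4, and |u|^2 <= 100 |s|^2. *)
rewrite (@le_trans _ _ (4 ^+ 2 *
   ((5 / 24 * modulus u ^+ 3) * (3 * modulus u)))) //.
  apply: ler_pM.
  - by rewrite exprn_ge0 // ltW.
  - by rewrite mulr_ge0 // modulus_ge0.
  - by rewrite ler_pXn2r ?nnegrE //; exact: ltW.
  - by apply: ler_pM => //; rewrite ?modulus_ge0.
have h5 : modulus u ^+ 2 <= (10 * modulus s) ^+ 2.
  by rewrite ler_pXn2r ?nnegrE ?mulr_ge0 // ltW.
have -> : 4 ^+ 2 * (5 / 24 * modulus u ^+ 3 * (3 * modulus u)) =
   10 * modulus u ^+ 2 * modulus u ^+ 2 by field.
have -> : 1000 * (modulus s * modulus u) ^+ 2 =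
  10 * (10 * modulus s) ^+ 2 * modulus u ^+ 2 by ring.
by rewrite ler_wpM2r ?exprn_ge0 ?ler_wpM2l // ltW.
Qed.

Lemma near_leq_exp2 x : \forall k \near \oo, x <= 2 ^+ k.
Proof.
exists (Num.bound `|x|) => // k /= hk.
rewrite (le_trans (ler_norm _)) // (le_trans (ltW (archi_boundP (normr_ge0 _)))) //.
by rewrite -natrX ler_nat (leq_trans hk) // ltnW // ltn_expl.
Qed.

(** Apply [cosec2_iter] with exponent k + 1 at the translate z - 2^k.  The
    difference is then 4^-(k+1) times a sum of 2^(k+1) terms bounded by
    [cosec2_pole]. *)
Lemma cosec2_dyadic z : ~ @integers R z ->
  \forall k \near \oo,
  modulus (cosec2 z - \sum_(j < 2 ^ k.+1) 1 / (z + j%:R - 2 ^+ k) ^+ 2)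
    <= 1000 / 2 ^+ k.+1.
Proof.
(* 100 |z| <= 2^k puts all the points [w j] in the region of [cosec2_pole]. *)
move=> zZ; have := near_leq_exp2 (100 * modulus z).
apply: filterS => k hk.
pose w (j : nat) := (z - 2 ^+ k + j%:R) / 2 ^+ k.+1.
have n0 : (2 : Cplx R) ^+ k != 0 by rewrite expf_neq0 // two_neq0.
have two0 : 0 < (2 : R) ^+ k by rewrite exprn_gt0.
have wE (j : nat) : w j = (z + ((j : int) - 2 ^+ k)%:~R) / 2 ^+ k.+1.
  by rewrite /w rmorphB rmorphXn /= addrAC addrA.
have zk : ~ @integers R (z + (- 2 ^+ k)%:~R).
  move=> [m _ mE]; apply: zZ; exists (m + 2 ^+ k) => //.
  by rewrite rmorphD /= mE rmorphN addrNK.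
have := cosec2_iter k.+1 zk; rewrite cosec2Dint.
rewrite rmorphN rmorphXn /= => E.
have -> : cosec2 z - \sum_(j < 2 ^ k.+1) 1 / (z + j%:R - 2 ^+ k) ^+ 2 =
    4 ^- k.+1 * \sum_(j < 2 ^ k.+1) (cosec2 (w j) - 1 / w j ^+ 2).
  rewrite sumrB -E mulrBr mulKf ?expf_neq0 ?pnatr_eq0 //; congr (_ - _).
  rewrite mulr_sumr; apply: eq_bigr => j _.
  have -> : (4 : Cplx R) ^- k.+1 = (2 ^+ k.+1) ^- 2.
    by rewrite -exprM mulnC exprM (_ : 2 ^+ 2 = 4) // -natrX.
  rewrite /w addrAC expr_div_n !div1r invf_div mulrA mulVf ?mul1r //.
rewrite modulusM modulusV modulusX modulus_nat.
have wj (j : 'I_(2 ^ k.+1)) : modulus (cosec2 (w j) - 1 / w j ^+ 2) <= 1000.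
  have jk : (j%:R : R) <= 2 * 2 ^+ k.
    by rewrite -exprS -natrX ler_nat ltnW.
  have M1 : (modulus z) / (2 * 2 ^+ k) <= 1 / 200.
    rewrite ler_pdivrMr ?mulr_gt0 //; lra.
  have M2 : modulus (j%:R - 2 ^+ k : Cplx R) / (2 * 2 ^+ k) <= 1 / 2.
    rewrite ler_pdivrMr ?mulr_gt0 //.
    rewrite -!ofreal_nat -ofrealX -ofrealN -ofrealD modulus_ofreal ler_norml.
    by have := ler0n R j; lra.
  have wM : modulus (w j) = modulus (z + (j%:R - 2 ^+ k)) / (2 * 2 ^+ k).
    rewrite /w modulusM modulusV modulusX modulus_nat exprS.
    by rewrite addrAC addrA.
  have I1 : complex.Im (w j) = (2 ^+ k.+1)^-1 * complex.Im z.
    rewrite wE mulrC -ofreal_nat -ofrealX -ofrealV Im_ofrealM; congr (_ * _).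
    by rewrite -ofreal_int; case: (z) => a b /=; rewrite addr0.
  apply: cosec2_pole.
  - apply/eqP => h; apply: (@not_integer_shift_scale z (j%:Z - 2 ^+ k) k.+1) => //.
    by rewrite -wE h; exists 0.
  - rewrite wM (@le_trans _ _ (1 / 200 + 1 / 2)) //; last lra.
    apply: le_trans (lerD M1 M2); rewrite -mulrDl ler_pM2r ?invr_gt0 ?mulr_gt0 //.
    exact: modulusD.
  - rewrite I1 normrM ger0_norm ?invr_ge0 ?exprn_ge0 // mulrC exprS.
    rewrite (@le_trans _ _ (modulus z / (2 * 2 ^+ k))) //; last lra.
    by rewrite ler_pM2r ?invr_gt0 ?mulr_gt0 // Im_le_modulus.
rewrite (@le_trans _ _ (4 ^- k.+1 * (1000 * 2 ^+ k.+1))) //.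
  rewrite ler_wpM2l ?invr_ge0 ?exprn_ge0 //.
  apply: le_trans (modulus_sum _ _ _) _.
  apply: le_trans (ler_sum _ (fun j _ => wj j)) _.
  by rewrite sumr_const card_ord -[_ *+ (2 ^ k.+1)]mulr_natr natrX.
have -> : (4 : R) = 2 ^+ 2 by ring.
rewrite -exprM mulnC exprM expr2 invfM.
by rewrite mulrCA -[_ * _ * 2 ^+ _]mulrA mulVf ?mulr1 // expf_neq0.
Qed.

End herglotz.

(** * The unconditional sum *)

(** The integers i with - N < i <= N.  The window is asymmetric because the
    iterated duplication formula sums over an even number of translates. *)
Fixpoint int_window (N : nat) : seq int :=
  if N is M.+1 then M.+1%:Z :: (- M%:Z) :: int_window M else [::].

Lemma mem_int_window N (i : int) :
  (i \in int_window N) = (- N%:Z < i) && (i <= N%:Z).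
Proof.
elim: N => [|N IH] /=; first by rewrite in_nil; apply/esym/negbTE; lia.
by rewrite !inE IH; apply/idP/idP; lia.
Qed.

Lemma int_window_uniq N : uniq (int_window N).
Proof.
elim: N => //= N ->; rewrite inE !mem_int_window andbT; lia.
Qed.

Lemma sum_int_window (V : zmodType) (F : int -> V) N :
  \sum_(i <- int_window N) F i = \sum_(j < 2 * N) F (N%:Z - j%:Z).
Proof.
elim: N => [|N IH]; first by rewrite muln0 big_nil big_ord0.
rewrite mulnS addSn add1n big_ord_recl big_ord_recr /= !big_cons IH.
rewrite subr0; congr (_ + _); rewrite [LHS]addrC; congr (_ + _).
  by apply: eq_bigr => j _; congr F; rewrite /bump /=; lia.
by congr F; rewrite /bump /=; lia.
Qed.

Lemma le_sum_subset (R : numDomainType) (I : eqType) (s t : seq I)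
    (P : pred I) (q : I -> R) :
  uniq s -> uniq t -> {subset s <= t} -> (forall i, 0 <= q i) ->
  \sum_(i <- s | P i) q i <= \sum_(i <- t | P i) q i.
Proof.
move=> us ut st q0.
have st' : perm_eq s [seq i <- t | i \in s].
  apply: uniq_perm; rewrite ?filter_uniq // => i.
  by rewrite mem_filter; case: (boolP (i \in s)) => // /st ->.
rewrite (perm_big _ st') /= big_filter_cond [leRHS](bigID (fun i => i \in s)) /=.
rewrite (eq_bigl (fun i => P i && (i \in s))); last by move=> i; rewrite andbC.
by rewrite lerDl sumr_ge0.
Qed.

(** Passing from the window of [N] to that of [N.+1] adds at most 2 / N^2, which
    is at most 4 / (N (N + 1)) = 4 / N - 4 / (N + 1). *)
Lemma sum_sqrV_tail (R : realType) (M N : nat) : (0 < M <= N)%N ->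
  \sum_(i <- int_window N | i \notin int_window M) ((i%:~R : R) ^+ 2)^-1
   <= 4 / M%:R - 4 / N%:R.
Proof.
move=> /andP[M0]; elim: N => [|N IH]; first by move: M0; case: M.
rewrite leq_eqVlt => /orP[/eqP <-|].
  rewrite subrr big_seq_cond big1 // => i /andP[h]; by rewrite h.
rewrite ltnS => MN; have N0 : (0 < N)%N by apply: leq_trans MN.
have r0 : (0 : R) < N%:R by rewrite ltr0n.
rewrite !big_cons.
have -> : N.+1%:Z \notin int_window M by rewrite mem_int_window; lia.
have -> : - N%:Z \notin int_window M by rewrite mem_int_window; lia.
have := IH MN; set S := \sum_(_ <- _ | _) _ => h.
rewrite rmorphN /= sqrrN -!pmulrn.
have a1 : (N.+1%:R ^+ 2)^-1 <= (N%:R ^+ 2)^-1 :> R.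
  by rewrite lef_pV2 ?posrE ?exprn_gt0 ?ltr0n // ler_pXn2r ?nnegrE // ler_nat.
have a2 : 2 * (N%:R ^+ 2)^-1 <= 4 / N%:R - 4 / N.+1%:R :> R.
  have -> : 4 / N%:R - 4 / N.+1%:R = 4 / (N%:R * N.+1%:R) :> R.
    by rewrite -natr1; field; rewrite ?(gt_eqF r0) ?gt_eqF //; lra.
  rewrite ler_pdivlMr ?mulr_gt0 ?ltr0n //.
  have -> : 2 * (N%:R ^+ 2)^-1 * (N%:R * N.+1%:R) = 2 * N.+1%:R / N%:R :> R.
    by field; rewrite gt_eqF.
  rewrite ler_pdivrMr // -natr1.
  have : (1 : R) <= N%:R by rewrite ler1n.
  lra.
apply: le_trans (lerD a1 (lerD (lexx _) h)) _; move: a2.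
move: (N%:R ^- 2) (4 / N%:R) (4 / N.+1%:R) (4 / M%:R) => a b c d.
lra.
Qed.

#[local] Existing Instance totally_filter.

Lemma int_seq_sub_window (s : seq int) : exists N, {subset s <= int_window N}.
Proof.
elim: s => [|i s [N hN]]; first by exists 0%N.
exists (N + absz i).+1 => j; rewrite inE => /orP[/eqP ->|/hN].
  by rewrite mem_int_window; lia.
by rewrite !mem_int_window; lia.
Qed.

Section sum.
Variable R : realType.
Implicit Types (z : Cplx R).

(** Outside the window |i| >= M >= 2 |z|, hence |z - i| >= |i| / 2. *)
Lemma far_term z (M : nat) (i : int) : 2 * modulus z <= M%:R ->
  i \notin int_window M -> (0 < M)%N ->
  modulus (1 / (z - i%:~R) ^+ 2) <= 4 * ((i%:~R : R) ^+ 2)^-1.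
Proof.
move=> zM iM M0.
have Mi : M%:R <= `|i%:~R| :> R.
  by rewrite -intr_norm -[M%:R]/(M%:~R) ler_int; move: iM; rewrite mem_int_window; lia.
have M1 : (0 : R) < M%:R by rewrite ltr0n.
have i0 : 0 < `|i%:~R| :> R by exact: lt_le_trans Mi.
have h : `|i%:~R| / 2 <= modulus (z - i%:~R).
  have := modulusB_ge (i%:~R) z; rewrite modulus_distC -ofreal_int modulus_ofreal.
  lra.
rewrite modulusM modulus1 mul1r modulusV modulusX -[_ ^+ 2 in leRHS]real_normK ?num_real //.
have -> : 4 * (`|i%:~R| ^+ 2)^-1 = ((`|i%:~R| / 2) ^+ 2)^-1 :> R.
  by field; rewrite gt_eqF.
have h2 : 0 < `|i%:~R| / 2 :> R by rewrite divr_gt0.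
rewrite lef_pV2 ?posrE ?exprn_gt0 ?(lt_le_trans h2 h) //.
by rewrite ler_pXn2r ?nnegrE ?modulus_ge0 ?(ltW h2).
Qed.

Lemma cosec2_window z : ~ @integers R z ->
  \forall k \near \oo,
  modulus (cosec2 z - \sum_(i <- int_window (2 ^ k)) 1 / (z - i%:~R) ^+ 2)
    <= 1000 / 2 ^+ k.+1.
Proof.
move=> /cosec2_dyadic; apply: filterS => k.
rewrite sum_int_window expnS.
rewrite (eq_bigr (fun j : 'I_(2 * 2 ^ k) =>
  1 / (z - ((2 ^ k)%N%:Z - j%:Z)%:~R) ^+ 2)) // => j _.
by rewrite -[in LHS]natrX rmorphB opprB addrA.
Qed.

(** A finite set that contains a large dyadic window has the sum of the window,
    close to the limit by [cosec2_window], plus a tail of terms beyond it. *)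
Lemma cvg_partial_sum_cosec2 z : ~ @integers R z ->
  partial_sum (fun n : int => 1 / (z - n%:~R) ^+ 2) @ totally --> cosec2 z.
Proof.
move=> zZ; set F := fun n : int => _.
apply: cvg_modulus => e e0.
(* The dyadic error is then at most e / 2, and the tail at most 16 e / 1000. *)
have [k [h1 h2 h3]] : exists k, [/\
    modulus (cosec2 z - \sum_(i <- int_window (2 ^ k)) F i) <= 1000 / 2 ^+ k.+1,
    2 * modulus z <= 2 ^+ k & 1000 / e <= 2 ^+ k].
  have [k kP] := @filter_ex _ _ _ _ (filterI (cosec2_window zZ)
    (filterI (near_leq_exp2 (2 * modulus z)) (near_leq_exp2 (1000 / e)))).
  by exists k; case: kP => ? [].
pose M := (2 ^ k)%N.
have M0 : (0 < M)%N by rewrite expn_gt0.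
have MR : M%:R = 2 ^+ k :> R by rewrite natrX.
have M1 : (0 : R) < M%:R by rewrite ltr0n.
exists (seq_fset tt (int_window M)) => // J /= /fsubsetP MJ.
have JE : partial_sum F J = \sum_(i <- int_window M) F i
    + \sum_(i <- J | i \notin int_window M) F i.
  rewrite /partial_sum -(big_seq_fsetE _ _ xpredT F) /= [LHS](bigID (mem (int_window M))) /=.
  congr (_ + _); rewrite -big_filter; apply: perm_big; apply: uniq_perm.
  - by rewrite filter_uniq // fset_uniq.
  - exact: int_window_uniq.
  - move=> i; rewrite mem_filter; case: (boolP (i \in int_window M)) => //= h.
    by apply: MJ; have -> := seq_fsetE tt (int_window M) i.
have tail : modulus (\sum_(i <- J | i \notin int_window M) F i) <= 16 / M%:R.
  have [N hN] := int_seq_sub_window (J ++ int_window M).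
  have MN : (M <= N)%N.
    have : M%:Z \in int_window N.
      by apply: hN; rewrite mem_cat mem_int_window; apply/orP; right; lia.
    by rewrite mem_int_window; lia.
  apply: le_trans (modulus_sum _ _ _) _.
  rewrite (@le_trans _ _ (\sum_(i <- J | i \notin int_window M)
     4 * ((i%:~R : R) ^+ 2)^-1)) //.
    by apply: ler_sum => i iM; apply: far_term iM M0; rewrite MR.
  rewrite -mulr_sumr.
  have := @le_sum_subset R _ J (int_window N) (fun i => i \notin int_window M)
     (fun i => ((i%:~R : R) ^+ 2)^-1).
  rewrite fset_uniq int_window_uniq => /(_ isT isT) h.
  have := @sum_sqrV_tail R M N; rewrite M0 MN => /(_ isT).
  have : (0 : R) <= 4 / N%:R by rewrite divr_ge0.
  have -> : 16 / M%:R = 4 * (4 / M%:R) :> R by field; rewrite gt_eqF.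
  move=> N4 t; rewrite ler_wpM2l //.
  apply: le_trans (h _ _) _; last lra.
  - by move=> i iJ; apply: hN; rewrite mem_cat iJ.
  - by move=> i; rewrite invr_ge0 sqr_ge0.
rewrite JE opprD addrA; apply: le_trans (modulusB _ _) _.
apply: le_trans (lerD h1 tail) _.
have e1 : 1000 / M%:R <= e.
  by rewrite ler_pdivrMr // mulrC -ler_pdivrMr // MR.
rewrite exprS -MR invfM.
have -> : 16 / M%:R = 16 / 1000 * (1000 / M%:R) :> R by field; rewrite gt_eqF.
have -> : 1000 * (2^-1 / M%:R) = 1 / 2 * (1000 / M%:R) :> R by field; rewrite gt_eqF.
lra.
Qed.

Lemma eis_fE z : ~ @integers R z -> eis_f z = cosec2 z.
Proof. by move=> zZ; apply: cvg_lim => //; exact: cvg_partial_sum_cosec2. Qed.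

End sum.
(** * Identification of pi and of the function c *)

Section basel.
Variable R : realType.

Definition zeta2_sum (N : nat) : R := \sum_(1 <= n < N) (1 / n%:R ^+ 2).

Lemma zeta2_sumS N : zeta2_sum N.+1 = zeta2_sum N + 1 / N%:R ^+ 2.
Proof.
case: N => [|N]; last by rewrite /zeta2_sum big_nat_recr.
(* For N = 0 the added term is 1 / 0, which is 0. *)
by rewrite /zeta2_sum !big_geq // expr0n /= invr0 mulr0 addr0.
Qed.

Lemma is_cvg_zeta2 : cvgn zeta2_sum.
Proof.
apply: nondecreasing_is_cvgn.
  apply/nondecreasing_seqP => n; rewrite zeta2_sumS lerDl.
  by rewrite divr_ge0 // exprn_ge0.
exists 2 => _ [N _ <-].
(* For n >= 2, 1 / n^2 <= 1 / (n - 1) - 1 / n, and this telescopes. *)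
have H M : zeta2_sum M.+2 <= 2 - 1 / M.+1%:R.
  elim: M => [|M IH].
    rewrite !zeta2_sumS /zeta2_sum big_geq // expr0n expr1n /= invr0; lra.
  rewrite zeta2_sumS; apply: le_trans (lerD IH (lexx _)) _.
  have m0 : 0 < M.+1%:R :> R by rewrite ltr0n.
  have -> : M.+2%:R = M.+1%:R + 1 :> R by rewrite natr1.
  move: m0; move: (M.+1%:R : R) => m m0.
  have m1 : 0 < m + 1 by lra.
  have : 1 / (m + 1) ^+ 2 <= 1 / m - 1 / (m + 1).
    have -> : 1 / m - 1 / (m + 1) = 1 / (m * (m + 1)).
      by field; rewrite (gt_eqF m0) (gt_eqF m1).
    rewrite !div1r lef_pV2 ?posrE ?exprn_gt0 ?mulr_gt0 ?addr_gt0 //.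
    by rewrite expr2 ler_pM2r ?addr_gt0 //; lra.
  lra.
case: N => [|[|N]].
- by rewrite /zeta2_sum big_geq.
- by rewrite /zeta2_sum big_geq.
- apply: le_trans (H N) _.
  by rewrite lerBlDr lerDl divr_ge0.
Qed.

(** The terms at z = 1/2 are 4 / (2 j + 1)^2, each taken twice, and the sum of
    the inverse odd squares is the full sum minus its even part, a quarter of
    a shorter sum of the same kind. *)
Lemma half_window M :
  \sum_(i <- int_window M) 1 / (ofreal (1 / 2 : R) - i%:~R) ^+ 2
  = ofreal (8 * zeta2_sum (2 * M) - 2 * zeta2_sum M).
Proof.
elim: M => [|M IH].
  by rewrite muln0 big_nil /zeta2_sum big_geq // !mulr0 subrr.
have term (i : int) : 1 / (ofreal (1 / 2 : R) - i%:~R) ^+ 2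
    = ofreal (1 / (1 / 2 - i%:~R) ^+ 2).
  rewrite [RHS]ofrealM [ofreal ((_ ^+ 2)^-1)]ofrealV ofrealX ofrealD ofrealN.
  by rewrite ofreal_int.
rewrite /= !big_cons IH mulnS addSn add1n !zeta2_sumS !term -!ofrealD.
congr ofreal; move: (zeta2_sum _) (zeta2_sum M) => a b.
rewrite rmorphN /= opprK -!pmulrn -[M.+1%:R]natr1 -[(2 * M).+1%:R]natr1 natrM.
have half : (1 / 2 + M%:R : R) ^+ 2 = (2 * M%:R + 1) ^+ 2 / 4 by field.
have halfS : (1 / 2 - (M%:R + 1) : R) ^+ 2 = (2 * M%:R + 1) ^+ 2 / 4 by field.
have odd0 : (2 * M%:R + 1 : R) != 0 by rewrite gt_eqF // ltr_wpDl // mulr_ge0.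
have even : 8 * (1 / (2 * M%:R) ^+ 2) = 2 * (1 / M%:R ^+ 2) :> R.
  by rewrite exprMn !div1r invfM mulrA; congr (_ * _); field.
rewrite half halfS; move: even odd0.
move: (1 / (2 * M%:R) ^+ 2 : R) (1 / M%:R ^+ 2 : R) (2 * M%:R + 1 : R) => p q o e o0.
have -> : 8 * (a + p + 1 / o ^+ 2) - 2 * (b + q)
   = 8 * a - 2 * b + 8 * (1 / o ^+ 2) + (8 * p - 2 * q) by ring.
by rewrite e subrr; field.
Qed.

Lemma half_not_integer : ~ @integers R (ofreal (1 / 2)).
Proof.
move=> [m _]; rewrite -ofreal_int => /ofreal_inj mE.
have : (m * 2)%:~R = 1%:~R :> R by rewrite rmorphM /= mE; field.
move/intr_inj; lia.
Qed.

Lemma cosec2_half : cosec2 (ofreal (1 / 2 : R)) = ofreal (pi ^+ 2).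
Proof.
rewrite /cosec2 -ofrealM (_ : pi * (1 / 2) = pi / 2); last by field.
by rewrite sinC_pihalf divr1 ofrealX.
Qed.

Lemma cvg_exp2 : (fun k => 2 ^ k)%N @ \oo --> \oo.
Proof.
move=> A [N _ HN]; exists N => // k /= hk; apply: HN.
by rewrite /= (leq_trans hk) // ltnW // ltn_expl.
Qed.

(** The windows at 1/2 converge to cosec2 (1/2) = pi^2, and by [half_window]
    also to (8 - 2) zeta (2). *)
Lemma zeta2E : 6 * limn zeta2_sum = pi ^+ 2 :> R.
Proof.
have h1 : (fun k => zeta2_sum (2 ^ k)) @ \oo --> limn zeta2_sum.
  exact: (cvg_comp _ _ cvg_exp2 is_cvg_zeta2).
have h2 : (fun k => zeta2_sum (2 ^ k.+1)) @ \oo --> limn zeta2_sum.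
  by rewrite -(cvg_shiftS (fun k => zeta2_sum (2 ^ k))) in h1.
have h3 : (fun k => 8 * zeta2_sum (2 ^ k.+1) - 2 * zeta2_sum (2 ^ k)) @ \oo
    --> 6 * limn zeta2_sum.
  have -> : 6 * limn zeta2_sum = 8 * limn zeta2_sum - 2 * limn zeta2_sum by ring.
  by apply: cvgB; apply: cvgM => //; exact: cvg_cst.
apply: cvg_unique h3 _ => //.
apply/cvgrPdist_le => e e0; have := cosec2_window half_not_integer.
have := near_leq_exp2 (1000 / e); apply: filterS2 => k hk.
rewrite cosec2_half half_window -expnS -ofrealN -ofrealD modulus_ofreal => h.
apply: le_trans h _; have k0 : (0 : R) < 2 ^+ k by rewrite exprn_gt0.
have : 1000 / 2 ^+ k <= e by rewrite ler_pdivrMr // mulrC -ler_pdivrMr.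
have : 0 <= 1000 / 2 ^+ k :> R by rewrite divr_ge0 ?ler0n ?(ltW k0).
rewrite exprS invfM.
have -> : 1000 * (2^-1 / 2 ^+ k) = 1 / 2 * (1000 / 2 ^+ k) :> R.
  by field; rewrite gt_eqF.
lra.
Qed.

Lemma eis_piE : eis_pi R = pi.
Proof.
rewrite /eis_pi -/zeta2_sum.
by rewrite [limn _](_ : _ = limn zeta2_sum) // zeta2E sqrtr_sqr ger0_norm // pi_ge0.
Qed.

(** Off the integers this is the double-angle formula
    cos z = 1 - 2 sin^2 (z / 2); at an integer w = z / (2 pi) the value 0 of g
    agrees with the zero of sin (pi w). *)
Lemma eis_cE : @eis_c R = @cosC R.
Proof.
apply/funext => z; rewrite /eis_c eis_piE /eis_g.
set w := z / _.
have p0 := ofreal_pi_neq0 R.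
have -> : cosC z = 1 - 2 * sinC (ofreal pi * w) ^+ 2.
  rewrite -cosC_double; congr cosC; rewrite /w.
  by rewrite mulrA mulrCA divff ?mulr1 // mulf_neq0 // two_neq0.
case: ifPn => [/set_mem|/negP] wZ.
  have -> : sinC (ofreal pi * w) = 0.
    case: wZ => n _ nw; have : cosec2 w = 0.
      rewrite -nw -[_%:~R]add0r cosec2Dint /cosec2 mulr0 sinC0 invr0 mulr0.
      by rewrite expr0n.
    move/eqP; rewrite expf_eq0 /= mulf_eq0 (negbTE p0) invr_eq0 => /eqP.
    by [].
  by rewrite expr0n /= !mulr0.
have {}wZ : ~ @integers R w by move=> h; apply: wZ; exact: mem_set.
have s0 : sinC (ofreal pi * w) != 0 by apply/eqP => /sinC_pi_eq0.
rewrite eis_fE // /cosec2; congr (_ - _).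
move: s0; move: (sinC _) => s s0; move: p0; move: (ofreal pi) => p p0.
by field; rewrite p0 s0.
Qed.
End basel.

Theorem mainTheorem3 (R : realType) :
  [/\ entire (@eis_c R),
      forall z : Cplx R, eis_c (z + 2 * ofreal (eis_pi R)) = eis_c z,
      [/\ forall z : Cplx R,
            derivable (derive1 (@eis_c R)) z 1 /\
            derive1 (derive1 (@eis_c R)) z + eis_c z = 0,
          eis_c (0 : Cplx R) = 1 &
          derive1 (@eis_c R) 0 = 0],
      forall z : Cplx R,
        series (fun n => (-1) ^+ n * (z ^+ (2 * n) / (2 * n)`!%:R)) @ \oo
          --> eis_c z &
      @eis_c R = @ccos R].
Proof.
rewrite eis_cE eis_piE.
have dcos : derive1 (@cosC R) = (fun z => - sinC z).
  apply/funext => z; rewrite derive1E.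
  exact: (@derive_val _ _ _ _ _ _ _ (is_derive_cosC z)).
have dsin (z : Cplx R) : is_derive z 1 (fun z : Cplx R => - sinC z) (- cosC z).
  exact: (is_deriveN (is_derive_sinC z)).
split.
- by move=> z; case: (is_derive_cosC z).
- by move=> z; exact: cosCD2pi.
- split.
  + move=> z; rewrite dcos; split; first by case: (dsin z).
    by rewrite derive1E (@derive_val _ _ _ _ _ _ _ (dsin z)) addNr.
  + exact: cosC0.
  + by rewrite dcos sinC0 oppr0.
- exact: cvg_cosC.
- apply/funext => z; symmetry; apply: cvg_lim => //; exact: cvg_cosC.
Qed.
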